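(* Let $X,Y,Z$ be Banach spaces, $K\subset Y$ and $Q\subset Z$ closed convex pointed cones, with $K\neq\{0\}$, $K\neq Y$ and $\operatorname{int}K\neq\emptyset$. Let $f:X\rightarrow Y$ be a map and $G:X\rightrightarrows Z$ a set-valued map, and consider the problem $$(P)\quad\text{minimize }f(x)\text{ subject to }x\in X,\ 0\in G(x)+Q.$$ Suppose that $\overline{x}\in G^{-1}(-Q)$ is a weak Pareto minimum point for $(P)$. Fix a point $\overline{q}\in Q$ with $(\overline{x},\overline{q},0)\in\operatorname{Gr}\mathcal{E}_G$. If $f$ is $L$-Lipschitz ($L>0$) and $\mathcal{E}_G$ is metrically subregular at $((\overline{x},\overline{q}),0)$ with a constant smaller than $M>0$, then, for every $e\in\operatorname{int}K$, $(\overline{x},\overline{q},0)$ is a local minimum point for the scalar function $$(x,q,z)\longmapsto s_e(f(x)-f(\overline{x}))+LL_eM\|z\|$$ under the constraint $(x,q,z)\in\operatorname{Gr}\mathcal{E}_G$.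
   Context: $G^{-1}(-Q)=\{x\in X\mid G(x)\cap(-Q)\neq\emptyset\}$. $\overline{x}\in G^{-1}(-Q)$ is a weak (Pareto) minimum point for $(P)$ if $(f(G^{-1}(-Q))-f(\overline{x}))\cap(-\operatorname{int}K)=\emptyset$. The map $\mathcal{E}_G:X\times Z\rightrightarrows Z$ is given by $\mathcal{E}_G(x,q)=G(x)+q$ if $q\in Q$ and $\mathcal{E}_G(x,q)=\emptyset$ otherwise; $\operatorname{Gr}\mathcal{E}_G=\{(x,q,z)\mid z\in\mathcal{E}_G(x,q)\}$. For $e\in\operatorname{int}K$, $s_e:Y\rightarrow\mathbb{R}$ is $s_e(y)=\inf\{\lambda\in\mathbb{R}\mid\lambda e\in y+K\}$, and $L_e:=d(e,\operatorname{bd}(K))^{-1}$, where $\operatorname{bd}(K)$ is the topological boundary of $K$ ($s_e$ is $L_e$-Lipschitz). A multifunction $F:X\rightrightarrows Y$ is metrically subregular with constant $c>0$ at $(\overline{x},\overline{y})\in\operatorname{Gr}F$ if there is a neighborhood $U$ of $\overline{x}$ such that $d(x,F^{-1}(\overline{y}))\leq c\,d(\overline{y},F(x))$ for every $x\in U$, where $F^{-1}(y)=\{x\mid y\in F(x)\}$ and $d(x,\emptyset)=\infty$. Product spaces carry the additive (sum) norm. *)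

(* Defs.v *)
From HB Require Import structures.
From mathcomp Require Import all_boot all_order all_algebra.
From mathcomp Require Import all_classical all_reals all_analysis.

Set Implicit Arguments.
Unset Strict Implicit.
Unset Printing Implicit Defensive.

Import Order.TTheory GRing.Theory Num.Theory.
Import numFieldNormedType.Exports.

Local Open Scope classical_set_scope.
Local Open Scope ring_scope.

Definition boundary {T : topologicalType} (A : set T) : set T :=
  closure A `\` A°.

(* Distances are parameters because the library norms X * Z by the maximum,
   whereas the metric used on products here is the sum one. *)
Definition norm_dist {R : realType} {V : normedModType R} (x y : V) : R :=
  `|x - y|.

Definition sum_dist {R : realType} {V W : normedModType R} (p p' : V * W) : R :=
  `|p.1 - p'.1| + `|p.2 - p'.2|.

(* The value is +oo when A is empty. *)
Definition dist_to_set {R : realType} {T : Type} (d : T -> T -> R)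
    (x : T) (A : set T) : \bar R :=
  ereal_inf [set (d x a)%:E | a in A].

Definition opp_set {V : zmodType} (A : set V) : set V := [set - a | a in A].

Definition is_cone {R : realType} {V : lmodType R} (K : set V) : Prop :=
  K !=set0 /\ forall (t : R) (v : V), 0 <= t -> K v -> K (t *: v).

Definition pointed {V : zmodType} (K : set V) : Prop :=
  K `&` opp_set K = [set 0].

Definition closed_convex_pointed_cone {R : realType} {V : normedModType R}
    (K : set V) : Prop :=
  [/\ closed K, is_cone K, convex_set K & pointed K].

(* A multifunction from T to U is a map T -> set U. *)
Definition graph_of {T U : Type} (F : T -> set U) : set (T * U) :=
  [set p | F p.1 p.2].

Definition inv_mult {T U : Type} (F : T -> set U) (y : U) : set T :=
  [set x | F x y].

Definition inv_image {T U : Type} (F : T -> set U) (B : set U) : set T :=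
  [set x | F x `&` B !=set0].

Definition weak_pareto_min {R : realType} {T : Type} {Y : normedModType R}
    (K : set Y) (f : T -> Y) (S : set T) (xbar : T) : Prop :=
  S xbar /\ [set f x - f xbar | x in S] `&` opp_set K° = set0.

Definition epi_mult {T : Type} {Z : zmodType} (G : T -> set Z) (Q : set Z)
    (p : T * Z) : set Z :=
  if p.2 \in Q then [set w + p.2 | w in G p.1] else set0.

Definition scalarization {R : realType} {Y : normedModType R} (K : set Y)
    (e y : Y) : R :=
  inf [set lam : R | [set y + k | k in K] (lam *: e)].

Definition scalarization_lip {R : realType} {Y : normedModType R} (K : set Y)
    (e : Y) : R :=
  (fine (dist_to_set norm_dist e (boundary K)))^-1.

Definition metrically_subregular {R : realType} {T U : topologicalType}
    (dT : T -> T -> R) (dU : U -> U -> R) (F : T -> set U)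
    (xbar : T) (ybar : U) (c : R) : Prop :=
  [/\ 0 < c, graph_of F (xbar, ybar) &
    exists2 V : set T, nbhs xbar V & forall x, V x ->
      (dist_to_set dT x (inv_mult F ybar)
         <= c%:E * dist_to_set dU ybar (F x))%E].

Definition local_min_on {R : realType} {T : topologicalType}
    (phi : T -> R) (A : set T) (p : T) : Prop :=
  A p /\ \forall p' \near p, A p' -> phi p <= phi p'.

(* Main.v *)
Require Import Defs.
From HB Require Import structures.
From mathcomp Require Import all_boot all_order all_algebra.
From mathcomp Require Import all_classical all_reals all_analysis.

Set Implicit Arguments.
Unset Strict Implicit.
Unset Printing Implicit Defensive.

Import Order.TTheory GRing.Theory Num.Theory.
Import numFieldNormedType.Exports.

Local Open Scope classical_set_scope.
Local Open Scope ring_scope.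

(** The ball of radius [d(e, bd K)] around [e] lies in [K]; scaling it gives
    [t e - v \in K] whenever [L_e |v| < t], which makes [s_e] finite and
    [L_e]-Lipschitz. For [(x, q, z)] in the graph near the reference point,
    subregularity provides a feasible [u] with [|x - u|] at most [c |z|] up to
    an arbitrarily small error. Weak minimality keeps [f u - f xbar] out of
    [- int K], so [s_e (f u - f xbar) >= 0], and replacing [u] by [x] lowers
    [s_e] by at most [L_e L |x - u|], which the penalty term compensates. *)

(** The last point of the segment that still lies in [A] is a boundary point; closedness of [A]
    ensures that the supremum of parameters is attained. *)
Lemma closed_segment_boundary (R : realType) (V : normedModType R) (A : set V)
    (a b : V) : closed A -> A a -> ~ A b ->
  exists2 c, boundary A c & `|a - c| <= `|a - b|.
Proof.
move=> Acl Aa Ab.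
pose p (t : R) := a + t *: (b - a).
have p_cont : continuous p.
  by move=> t; apply: cvgD; [exact: cvg_cst | apply: cvgZl; exact: cvg_id].
pose S := [set t : R | 0 <= t <= 1 /\ A (p t)].
have S0 : S 0 by split; rewrite /= ?lexx ?ler01// /p scale0r addr0.
have Sub : has_ubound S by exists 1 => t [/andP[]].
have s0 : 0 <= sup S by exact: ub_le_sup.
have s1 : sup S <= 1 by apply: ge_sup; [exists 0 | move=> t [/andP[]]].
have Aps : A (p (sup S)).
  have pcl : closed (p @^-1` A) by apply: preimage_closed => // t _; exact: p_cont.
  apply: pcl; apply: (closureS (A := S)) => [t []//|].
  by apply: closure_sup => //; exists 0.
exists (p (sup S)); last first.
  rewrite /p opprD addNKr normrN normrZ ger0_norm// distrC.
  exact: ler_piMl.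
split; first exact: subset_closure.
move=> /p_cont/nbhs_ballP[eps /= eps0 epsA].
have s_lt1 : sup S < 1.
  rewrite lt_neqAle s1 andbT; apply/eqP => sE; apply: Ab.
  by move: Aps; rewrite sE /p scale1r addrC subrK.
(* If [p (sup S)] were interior, a step of length [del] would stay in [A] and not pass the parameter
   1, contradicting the supremum. *)
pose del := Num.min (eps / 2) (1 - sup S).
have del0 : 0 < del by rewrite lt_min divr_gt0// subr_gt0.
have /(ub_le_sup Sub) : S (sup S + del).
  split; last first.
    apply: epsA; rewrite -ball_normE/= opprD addNKr normrN gtr0_norm//.
    by rewrite gt_min ltr_pdivrMr// ltr_pMr// ltr1n.
  by rewrite addr_ge0 ?(ltW del0)//= -lerBrDl ge_min lexx orbT.
by rewrite gerDl leNgt del0.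
Qed.

(** A ball around [e] inside [A] misses the boundary, and the segment to a point outside [A] meets
    it, so the distance is positive and finite. A point outside [A] is never closer to [e] than the
    boundary point on its segment. *)
Lemma dist_boundary (R : realType) (V : normedModType R) (A : set V) (e : V) :
    closed A -> A <> setT -> A° e ->
  exists d, [/\ 0 < d, dist_to_set norm_dist e (boundary A) = d%:E &
    forall v, `|e - v| < d -> A v].
Proof.
move=> Acl AT eA.
have Ae : A e by exact: interior_subset.
have /existsNP[b Ab] : ~ forall b, A b by move=> h; apply: AT; apply/seteqP; split.
have [c cA _] := closed_segment_boundary Acl Ae Ab.
have [r /= r0 rA] := (nbhs_ballP _ _).1 (nbhs_interior eA).
set D := dist_to_set _ _ _.
have Dr : (r%:E <= D)%E.
  apply/ereal_infP => _ [v [_ vA] <-]; rewrite lee_fin leNgt; apply/negP => vr.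
  by apply: vA; apply: rA; rewrite -ball_normE.
have Dc : (D <= `|e - c|%:E)%E by apply: ereal_inf_lbound; exists c.
have Dfin : D \is a fin_num.
  by rewrite fin_numE; apply/andP; split; apply/eqP => DE; move: Dr Dc; rewrite DE.
exists (fine D); rewrite fineK//; split=> //.
  by rewrite -lte_fin fineK// (lt_le_trans _ Dr)// lte_fin.
move=> v vD; apply: contrapT => /(closed_segment_boundary Acl Ae)[w wA wv].
move: vD; rewrite -lte_fin fineK//; apply/negP; rewrite -leNgt.
apply: (@le_trans _ _ `|e - w|%:E); last by rewrite lee_fin.
by apply: ereal_inf_lbound; exists w.
Qed.

(** The sum is the midpoint of [2 a] and [2 b]. *)
Lemma convex_cone_add (R : realType) (V : lmodType R) (K : set V) (a b : V) :
  is_cone K -> convex_set K -> K a -> K b -> K (a + b).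
Proof.
move=> [_ Kc] Kv Ka Kb.
have h : 1 - 2^-1 = 2^-1 :> R by rewrite [X in X - _]splitr mul1r addrK.
have K2 v : K v -> 2%:R *: v \in (K : set (convex_lmodType V)).
  by move=> Kv'; apply/mem_set; apply: Kc.
have h0 : (0 : R) <= 2^-1 by rewrite invr_ge0.
have h1 : (2^-1 : R) <= 1 by rewrite invf_le1 ?ler1n.
have := Kv _ _ (Itv01 h0 h1) (K2 _ Ka) (K2 _ Kb).
move=> /set_mem; rewrite /conv/= /unstable.onem.
by rewrite h !scalerA mulVf ?pnatr_eq0// !scale1r.
Qed.

Lemma scalarizationE (R : realType) (Y : normedModType R) (K : set Y) (e y : Y) :
  scalarization K e y = inf [set lam | K (lam *: e - y)].
Proof.
congr inf; apply/seteqP; split=> lam /=.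
  by move=> [k Kk <-]; rewrite addrAC subrr add0r.
by move=> Kl; exists (lam *: e - y) => //; rewrite addrC subrK.
Qed.

Section scalarization_theory.
Context (R : realType) (Y : normedModType R) (K : set Y) (e : Y).
Hypotheses (Kcl : closed K) (Kcone : is_cone K) (Kconv : convex_set K).
Hypotheses (KT : K <> setT) (eK : K° e).

Let Ke : K e. Proof. exact: interior_subset. Qed.

Lemma scalarization_lip_gt0 : 0 < scalarization_lip K e.
Proof.
have [d [d0 dE _]] := dist_boundary Kcl KT eK.
by rewrite /scalarization_lip dE invr_gt0.
Qed.

Let Le := scalarization_lip K e.

Lemma cone_ball (t : R) (v : Y) : Le * `|v| < t -> K (t *: e - v).
Proof.
have [d [d0 dE dK]] := dist_boundary Kcl KT eK.
rewrite /Le /scalarization_lip dE/= => vt.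
have t0 : 0 < t by apply: le_lt_trans vt; rewrite mulr_ge0// invr_ge0 ltW.
have -> : t *: e - v = t *: (e - t^-1 *: v).
  by rewrite scalerBr scalerA mulfV ?scale1r// gt_eqF.
apply: Kcone.2; first exact: ltW.
apply: dK; rewrite opprB addrCA subrr addr0 normrZ gtr0_norm ?invr_gt0//.
by rewrite ltr_pdivrMl// mulrC -ltr_pdivrMl.
Qed.

Let has_large (y : Y) : exists2 t : R, 0 < t & Le * `|y| < t.
Proof.
exists (Le * `|y| + 1); last by rewrite ltrDl.
by rewrite ltr_wpDl// mulr_ge0// ltW// scalarization_lip_gt0.
Qed.

(* Otherwise [v = (t e + v) + t (- e)] would be in [K] for every [v], [t] large. *)
Let KNe : ~ K (- e).
Proof.
move=> KN; apply: KT; apply/seteqP; split=> // v _.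
have [t t0] := has_large (- v); move=> /cone_ball Kt.
rewrite -[v](_ : (t *: e - - v) + t *: (- e) = v).
  by apply: convex_cone_add => //; apply: Kcone.2 => //; exact: ltW.
by rewrite scalerN opprK addrAC subrr add0r.
Qed.

Let scal_nonempty (y : Y) : [set lam | K (lam *: e - y)] !=set0.
Proof. by have [t _ /cone_ball Kt] := has_large y; exists t. Qed.

(** Together with nonemptiness, this makes [inf] a genuine infimum instead of its default value
    0. *)
Let scal_lbound (y : Y) : has_lbound [set lam | K (lam *: e - y)].
Proof.
have [t t0] := has_large (- y); move=> /cone_ball Kt.
exists (- t) => lam /= Kl; rewrite leNgt; apply/negP => lt.
have c0 : 0 < - (lam + t) by rewrite oppr_gt0 -ltrBDr sub0r.
(* In this sum [y] cancels, leaving a negative multiple of [e] in [K]; rescaling gives [- e]. *)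
have /(Kcone.2 _ _ (ltW (_ : 0 < (- (lam + t))^-1))) :
    K ((lam *: e - y) + (t *: e - - y)) by exact: convex_cone_add.
rewrite opprK addrACA -scalerDl addNr addr0 scalerA invrN mulNr mulVf.
  by rewrite scaleN1r => h; apply: KNe; apply: h; rewrite -invrN invr_gt0.
by rewrite -oppr_eq0 gt_eqF.
Qed.

Lemma scalarization0_le0 : scalarization K e 0 <= 0.
Proof.
rewrite scalarizationE; apply: ge_inf => //=.
by rewrite scale0r subr0 -(scale0r e); exact: Kcone.2.
Qed.

(** Adding [r e - (y - y')], which [cone_ball] puts in [K], turns an admissible [lam] for [y'] into
    [lam + r] for [y]. The slack [eps] in [r] supplies the strict inequality. *)
Lemma scalarization_lipschitz (y y' : Y) :
  scalarization K e y <= scalarization K e y' + Le * `|y - y'|.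
Proof.
apply/ler_addgt0Pr => eps eps0.
rewrite -addrA; set r := _ + eps.
rewrite !scalarizationE -lerBlDr; apply: lb_le_inf => // lam /= Kl.
rewrite lerBlDr; apply: ge_inf => //=.
rewrite (_ : _ - y = (lam *: e - y') + (r *: e - (y - y'))).
  by apply: convex_cone_add => //; apply: cone_ball; rewrite ltrDl.
by rewrite scalerDl addrACA opprB addKr.
Qed.

Lemma scalarization_ge0 (y : Y) : ~ K° (- y) -> 0 <= scalarization K e y.
Proof.
move=> yK; rewrite scalarizationE; apply: lb_le_inf => // lam /= Kl.
rewrite leNgt; apply/negP => lam0; apply: yK.
(* A negative admissible [lam] would make [- y] interior: with this radius, [cone_ball] at
   [t = - lam] absorbs the displacement [- y - v]. *)
apply/nbhs_ballP; exists (Le^-1 * - lam) => /=.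
  by rewrite mulr_gt0 ?oppr_gt0// invr_gt0 scalarization_lip_gt0.
move=> v; rewrite -ball_normE/= => vb.
rewrite (_ : v = (lam *: e - y) + ((- lam) *: e - (- y - v))).
  apply: convex_cone_add => //; apply: cone_ball.
  by rewrite -ltr_pdivlMl// scalarization_lip_gt0.
by rewrite addrACA scaleNr subrr add0r opprB opprK addrCA addNr addr0.
Qed.

End scalarization_theory.

Lemma inv_epi_mult_feasible (T : Type) (Z : zmodType) (G : T -> set Z)
    (Q : set Z) (u : T) (q : Z) :
  inv_mult (epi_mult G Q) 0 (u, q) -> inv_image G (opp_set Q) u.
Proof.
rewrite /inv_mult /epi_mult /=; case: ifPn => // /set_mem Qq [w Gw /eqP].
by rewrite addr_eq0 => /eqP wq; exists w; split=> //; exists q.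
Qed.

Theorem theorem4p3 (R : realType) (X Y Z : completeNormedModType R)
  (K : set Y) (Q : set Z)
  (hK : closed_convex_pointed_cone K) (hQ : closed_convex_pointed_cone Q)
  (hK0 : K <> [set 0]) (hKT : K <> setT) (hKint : K° !=set0)
  (f : X -> Y) (G : X -> set Z) (xbar : X)
  (hmin : weak_pareto_min K f (inv_image G (opp_set Q)) xbar)
  (qbar : Z) (hqbar : Q qbar)
  (hgr : graph_of (epi_mult G Q) ((xbar, qbar), 0))
  (L : R) (hL : 0 < L) (hf : L.-lipschitz f)
  (M : R) (hM : 0 < M)
  (hsub : exists2 c : R, c < M &
     metrically_subregular sum_dist norm_dist (epi_mult G Q) (xbar, qbar) 0 c) :
  forall e : Y, K° e ->
    local_min_on
      (fun p : X * Z * Z =>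
         scalarization K e (f p.1.1 - f xbar)
           + L * scalarization_lip K e * M * `|p.2|)
      (graph_of (epi_mult G Q)) ((xbar, qbar), 0).
Proof.
move=> e eK; have [Kcl Kcone Kconv _] := hK.
have [c cM [c0 _ [V nV subV]]] := hsub.
set Le := scalarization_lip K e.
have Le0 : 0 < Le := scalarization_lip_gt0 Kcl hKT eK.
split=> //.
have : \forall p \near ((xbar, qbar), 0 : Z), V p.1 by exact: cvg_fst.
apply: filterS => -[[x q] z] /= Vxq; rewrite /graph_of /= => Exqz.
rewrite subrr normr0 mulr0 addr0.
(* The reference value is at most 0, so nonnegativity of the penalized value at [(x, q, z)]
   suffices. *)
apply: (le_trans (scalarization0_le0 Kcl Kcone Kconv hKT eK)).
apply/ler_addgt0Pr => eps eps0.
(* The composite Lipschitz factor [L * Le] will turn this error into exactly [eps]. *)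
have eps'0 : 0 < eps / (L * Le) by rewrite divr_gt0// mulr_gt0.
have : (dist_to_set sum_dist (x, q) (inv_mult (epi_mult G Q) 0%R)
    < (c * `|z| + eps / (L * Le))%:E)%E.
  apply: le_lt_trans (subV _ Vxq) _.
  apply: (@le_lt_trans _ _ (c * `|z|)%:E); last by rewrite lte_fin ltrDl.
  (* As [z] belongs to the value at [(x, q)], that value is within [|z|] of 0. *)
  rewrite EFinM lee_pmul2l//; apply: ereal_inf_lbound; exists z => //.
  by rewrite /norm_dist sub0r normrN.
move=> /ereal_inf_lt[_ [[u q'] uq' <-]].
have ufeas := inv_epi_mult_feasible uq'.
rewrite lte_fin /sum_dist/= => xu.
have fu0 : 0 <= scalarization K e (f u - f xbar).
  apply: scalarization_ge0 => // Kint.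
  have [_ min0] := hmin.
  suff : set0 (f u - f xbar) by [].
  rewrite -min0; split; first by exists u.
  by exists (- (f u - f xbar)) => //; rewrite opprK.
have lips : scalarization K e (f u - f xbar) <=
    scalarization K e (f x - f xbar) + Le * `|f x - f u|.
  have := scalarization_lipschitz Kcl Kcone Kconv hKT eK
    (f u - f xbar) (f x - f xbar).
  by rewrite opprB addrA subrK (distrC (f u)).
have fxu : `|f x - f u| <= L * `|x - u| by exact: (hf (x, u)).
apply: (le_trans fu0); apply: (le_trans lips).
rewrite -addrA lerD2l.
apply: (@le_trans _ _ (Le * (L * (c * `|z| + eps / (L * Le))))).
  rewrite ler_pM2l//; apply: (le_trans fxu); rewrite ler_pM2l//.
  (* The sum distance dominates its first term [|x - u|]. *)
  by apply: le_trans (ltW xu); rewrite lerDl.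
rewrite !mulrDr !mulrA (mulrC Le L) lerD//.
  by rewrite ler_wpM2r// ler_pM2l ?mulr_gt0// ltW.
by rewrite mulrAC mulfV ?mul1r// mulf_neq0// gt_eqF.
Qed.
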